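(* Let $\mathcal{P}=(p_k)_{k\in\mathbb{N}_0}$ be a sequence of integers $p_k\ge 2$ with $\sup_k p_k=\infty$, and let $(R_k)_{k\in\mathbb{N}_0}$ be the corresponding generalized Rademacher functions. Then for every integer $d\ge1$ and every $q>2$, the subsystem $$C^d_R=\bigl\{R_{k_0}^{j_0}\cdots R_{k_{d-1}}^{j_{d-1}} : k_0<\dots<k_{d-1},\ 1\le j_i<p_{k_i}\bigr\}$$ of the (unbounded) Vilenkin system associated with $\mathcal{P}$ is not a $q$-lacunary system.
   Context: $\mathbb{N}_0=\{0,1,2,\ldots\}$. Let $\mathbb{G}_{\mathcal{P}}=\prod_{k=0}^\infty\mathbb{Z}_{p_k}$ with elements $g=(g_0,g_1,\ldots)$, $g_k\in\{0,\ldots,p_k-1\}$, equipped with normalized Haar measure. The generalized Rademacher functions are $R_k(g)=\exp(2\pi i g_k/p_k)$, $k\in\mathbb{N}_0$. Put $P_0=1$, $P_k=\prod_{j=0}^{k-1}p_j$. The Vilenkin system (the system of characters of $\mathbb{G}_{\mathcal{P}}$) consists of the functions $V_n=\prod_{k=0}^\infty R_k^{n_k}$, where $n=\sum_{k}n_kP_k$, $n_k\in\{0,\ldots,p_k-1\}$, $n\in\mathbb{N}_0$. Up to a countable set, $\mathbb{G}_{\mathcal{P}}$ is identified with $[0,1)$ with Lebesgue measure via $g\mapsto\sum_{k}g_k/P_{k+1}$. The Vilenkin system is unbounded if $\sup_kp_k=\infty$. A system of functions $(\varphi_k)$ is called $q$-lacunary ($2<q<\infty$) if there is a constant $\kappa=\kappa(q)>0$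 such that for every finite sum $\sum_kc_k\varphi_k$ over distinct elements of the system with coefficients $c_k\in\mathbb{C}$, $\bigl\|\sum_kc_k\varphi_k\bigr\|_{L_q}\le\kappa\bigl(\sum_k|c_k|^2\bigr)^{1/2}$. *)

(* Defs.v *)
From HB Require Import structures.
From mathcomp Require Import all_boot all_order all_algebra.
From mathcomp Require Import all_classical all_reals all_analysis.
From mathcomp Require Import complex.

Set Implicit Arguments.
Unset Strict Implicit.
Unset Printing Implicit Defensive.
Import Order.TTheory GRing.Theory Num.Theory.
Import numFieldNormedType.Exports.

Local Open Scope classical_set_scope.
Local Open Scope ring_scope.

Section group.
Variable p : nat -> nat.

(* ['Z_n] is the ring of integers mod n only for 1 < n; all statements about
   [vgroup p] assume [forall k, 1 < p k]. *)
Definition vgroup : Type := prod_topology (fun k => discrete_topology 'Z_(p k)).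

HB.instance Definition _ := Topological.copy vgroup
  (prod_topology (fun k => discrete_topology 'Z_(p k))).

Definition vgroup_zero : vgroup := fun k => (0 : 'Z_(p k)).
Definition vgroup_opp (g : vgroup) : vgroup := fun k => - (g k : 'Z_(p k)).
Definition vgroup_add (g h : vgroup) : vgroup :=
  fun k => (g k : 'Z_(p k)) + (h k : 'Z_(p k)).

Fact vgroup_addA : associative vgroup_add.
Proof. by move=> f g h; apply/functional_extensionality_dep => k; exact: addrA. Qed.
Fact vgroup_addC : commutative vgroup_add.
Proof. by move=> f g; apply/functional_extensionality_dep => k; exact: addrC. Qed.
Fact vgroup_add0 : left_id vgroup_zero vgroup_add.
Proof. by move=> f; apply/functional_extensionality_dep => k; exact: add0r. Qed.
Fact vgroup_addN : left_inverse vgroup_zero vgroup_opp vgroup_add.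
Proof. by move=> f; apply/functional_extensionality_dep => k; exact: addNr. Qed.

HB.instance Definition _ := GRing.isZmodule.Build vgroup
  vgroup_addA vgroup_addC vgroup_add0 vgroup_addN.
HB.instance Definition _ := isPointed.Build vgroup 0.

Definition borel_vgroup := g_sigma_algebraType (@open vgroup).

(* Normalization is part of [probability]; the group being abelian, left and
   right invariance coincide. *)
Definition normalized_haar (R : realType) (mu : probability borel_vgroup R) :=
  forall (a : vgroup) (A : set vgroup), measurable (A : set borel_vgroup) ->
    mu [set a + g | g in A] = mu A.

End group.

Section systems.
Variables (R : realType) (p : nat -> nat).

Definition expi (t : R) : R[i] := Complex (cos t) (sin t).

Definition rademacher (k : nat) (g : vgroup p) : R[i] :=
  expi (2 * pi * (g k : 'Z_(p k))%:R / (p k)%:R).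

Definition vilenkin_base (k : nat) : nat := (\prod_(j < k) p j)%N.

Definition vilenkin_digit (n k : nat) : nat :=
  ((n %/ vilenkin_base k) %% p k)%N.

(* When all the [p k] are at least 2, [n < vilenkin_base k] for [n <= k], so
   the digits of [n] of rank at least [n] vanish. *)
Definition vilenkin (n : nat) (g : vgroup p) : R[i] :=
  \prod_(k < n) rademacher k g ^+ vilenkin_digit n k.

Definition vilenkin_system : set (vgroup p -> R[i]) := range vilenkin.

Definition rademacher_chaos (d : nat) : set (vgroup p -> R[i]) :=
  [set f | exists (k j : 'I_d -> nat),
     [/\ {homo k : a b / (a < b)%N},
         forall i, (1 <= j i < p (k i))%N &
         f = (fun g => \prod_(i < d) rademacher (k i) g ^+ j i)]].

Lemma rademacher_chaos_vilenkin (d : nat) :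
  (forall k, 2 <= p k)%N -> rademacher_chaos d `<=` vilenkin_system.
Proof.
move=> p2.
have p0 k : (0 < p k)%N by exact: leq_trans (p2 k).
have baseS k : vilenkin_base k.+1 = (vilenkin_base k * p k)%N.
  by rewrite /vilenkin_base big_ord_recr.
have base0 k : (0 < vilenkin_base k)%N.
  by rewrite /vilenkin_base prodn_gt0.
have baseM m k : (m <= k)%N -> (vilenkin_base m %| vilenkin_base k)%N.
  elim: k => [|k IH]; first by rewrite leqn0 => /eqP ->.
  rewrite leq_eqVlt ltnS => /orP[/eqP-> //|/IH h].
  by rewrite baseS dvdn_mulr.
have base_gt k : (k < vilenkin_base k)%N.
  elim: k => [|k IH]; first exact: base0.
  rewrite baseS; apply: (leq_ltn_trans IH).
  by rewrite ltn_Pmulr // p2.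
pose val (e : nat -> nat) N := (\sum_(l < N) e l * vilenkin_base l)%N.
have val_lt e N : (forall l, e l < p l)%N -> (val e N < vilenkin_base N)%N.
  move=> he; elim: N => [|N IH]; first by rewrite /val big_ord0 base0.
  rewrite /val big_ord_recr /= -/(val e N) baseS.
  apply: (@leq_trans (vilenkin_base N + e N * vilenkin_base N)).
    by rewrite ltn_add2r.
  by rewrite -mulSn mulnC leq_mul2l he orbT.
have val_dig e N k : (forall l, e l < p l)%N -> (k < N)%N ->
    vilenkin_digit (val e N) k = e k.
  move=> he; elim: N => // N IH; rewrite ltnS leq_eqVlt => /orP[/eqP ->|kN].
    rewrite /vilenkin_digit /val big_ord_recr /= -/(val e N).
    by rewrite divnDr ?dvdn_mull // divn_small ?val_lt // add0n mulnK // modn_small.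
  rewrite -(IH kN) /vilenkin_digit /val big_ord_recr /= -/(val e N).
  have := baseM _ _ kN; rewrite baseS => /dvdnP[c ->].
  rewrite divnDr; last by rewrite mulnCA mulnA mulnA dvdn_mulr // dvdn_mull.
  rewrite (_ : e N * _ = e N * c * p k * vilenkin_base k)%N; last first.
    by rewrite [(vilenkin_base k * p k)%N]mulnC !mulnA.
  by rewrite mulnK // addnC modnMDl.
have dig0 n k : (n < vilenkin_base k)%N -> vilenkin_digit n k = 0%N.
  by move=> h; rewrite /vilenkin_digit divn_small // mod0n.
move=> _ [k [j [kinc hj ->]]].
have kinj : injective k.
  move=> a b kab; apply/val_inj/eqP.
  by case: ltngtP => // /kinc; rewrite kab ltnn.
pose e (l : nat) := (\sum_(i < d | k i == l) j i)%N.
have ek i : e (k i) = j i.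
  by rewrite /e (big_pred1 i) // => i' /=; rewrite (inj_eq kinj).
have he l : (e l < p l)%N.
  have [i /eqP <-|no] := pickP (fun i => k i == l).
    by rewrite ek; case/andP: (hj i).
  by rewrite /e big_pred0.
pose N := (\max_(i < d) k i).+1.
have kN i : (k i < N)%N by rewrite ltnS leq_bigmax.
have e0 l : (N <= l)%N -> e l = 0%N.
  move=> Nl; rewrite /e big_pred0 // => i.
  by apply/negbTE; rewrite neq_ltn (leq_trans (kN i) Nl).
exists (val e N) => //; apply/funext => g; rewrite /vilenkin.
pose M := maxn (val e N) N.
transitivity (\prod_(l < M) rademacher l g ^+ e l).
  rewrite (big_ord_widen M (fun l => rademacher l g ^+ vilenkin_digit (val e N) l))
    ?leq_maxl //.
  rewrite [LHS]big_mkcond; apply: eq_bigr => l _ /=.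
  have dl : vilenkin_digit (val e N) l = e l.
    have [lN|Nl] := ltnP l N; first exact: val_dig.
    rewrite e0 // dig0 //; apply: (leq_trans (val_lt _ _ he)).
    exact: dvdn_leq (base0 _) (baseM _ _ Nl).
  rewrite dl; case: ltnP => // vl; rewrite -dl dig0 //.
  exact: leq_ltn_trans vl (base_gt _).
have kM i : (k i < M)%N by rewrite (leq_trans (kN i)) // leq_maxr.
transitivity (\prod_(l < M) \prod_(i < d | Ordinal (kM i) == l)
                rademacher (k i) g ^+ j i).
  apply: eq_bigr => l _.
  have [a /eqP il|no] := pickP (fun i => Ordinal (kM i) == l).
    rewrite (big_pred1 a); first by rewrite -il /= ek.
    by move=> b /=; rewrite -il -(inj_eq val_inj) /= (inj_eq kinj).
  by rewrite big_pred0 // /e big_pred0.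
by rewrite [RHS](partition_big (fun i => Ordinal (kM i)) xpredT).
Qed.

End systems.

Definition lacunary d (T : measurableType d) (R : realType)
    (mu : {measure set T -> \bar R}) (q : R) (Phi : set (T -> R[i])) :=
  exists2 kappa : R, 0 < kappa &
    forall (n : nat) (phi : 'I_n -> T -> R[i]) (c : 'I_n -> R[i]),
      injective phi -> (forall i, Phi (phi i)) ->
      ('N[mu]_(q%:E)[(fun x => (Normc.normc (\sum_(i < n) c i * phi i x))%:E)]
         <= (kappa * Num.sqrt (\sum_(i < n) Normc.normc (c i) ^+ 2))%:E)%E.

(* Main.v *)
(** Choose [K >= d - 1] with [P = p_K] large, and consider the [P - 1] chaos
    elements [R_0 ... R_(d-2) R_K^j], [1 <= j < P]. Their sum has modulus [P - 1]
    on [{g | g_K = 0}], whose Haar measure is [1/P] because its [P] translates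
    partition the group. Lacunarity with constant [kappa] would thus give
    [(P - 1) P^(-1/q) <= kappa sqrt (P - 1)], so [P^(1/2 - 1/q)] would be bounded
    by [2 kappa]; this is false for large [P], since [q > 2]. *)
Require Import Defs.
From HB Require Import structures.
From mathcomp Require Import all_boot all_order all_algebra.
From mathcomp Require Import all_classical all_reals all_analysis.
From mathcomp Require Import complex measurable_realfun ring lra zify.
Import Order.TTheory GRing.Theory Num.Theory.
Import numFieldNormedType.Exports.

Local Open Scope classical_set_scope.
Local Open Scope ring_scope.

(** * Unimodular exponentials and the powers of a Rademacher function *)

Section expi_theory.
Variable R : realType.
Implicit Types t u : R.

Lemma expi0 : expi (0 : R) = 1.
Proof. by rewrite /expi cos0 sin0. Qed.

Lemma expiD t u : expi (t + u) = expi t * expi u.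
Proof. by rewrite /expi cosD sinD; simpc; congr Complex; ring. Qed.

Lemma expiMn t n : expi (t *+ n) = expi t ^+ n.
Proof. by elim: n => [|n IH]; rewrite ?mulr0n ?expi0// mulrS expiD IH exprS. Qed.

Lemma normc_expi t : Normc.normc (expi t) = 1.
Proof. by rewrite /Normc.normc /expi cos2Dsin2 sqrtr1. Qed.

(** Half-angle argument: [cos t = 1] would force [sin (t / 2) = 0], yet [t / 2] lies strictly
    between 0 and [pi]. *)
Lemma expi_neq1 t : 0 < t < 2 * pi -> expi t <> 1.
Proof.
move=> /andP[t0 tpi] [ct _].
have st : 0 < sin (t / 2) by apply: sin_gt0_pi; apply/andP; split; lra.
have : cos (t / 2 *+ 2) = 1 by rewrite -[RHS]ct; congr cos; rewrite -mulr_natr; lra.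
rewrite cos_mulr2n cos2sin2; nra.
Qed.

End expi_theory.

Lemma normc_prod (R : rcfType) (I : Type) (r : seq I) (F : I -> R[i]) :
  Normc.normc (\prod_(i <- r) F i) = \prod_(i <- r) Normc.normc (F i).
Proof. exact: (big_morph _ (@Normc.normcM R) (@Normc.normc1 R)). Qed.

Lemma normcX (R : rcfType) (z : R[i]) n :
  Normc.normc (z ^+ n) = Normc.normc z ^+ n.
Proof. by elim: n => [|n IH]; rewrite ?Normc.normc1// !exprS Normc.normcM IH. Qed.

Section rademacher_theory.
Variables (R : realType) (p : nat -> nat).

Lemma normc_rademacher k (g : vgroup p) : Normc.normc (rademacher R k g) = 1.
Proof. exact: normc_expi. Qed.

Lemma rademacher_digit0 k (g : vgroup p) :
  (g k : 'Z_(p k)) = 0 -> rademacher R k g = 1.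
Proof. by move=> gk; rewrite /rademacher gk mulr0 mul0r expi0. Qed.

Definition vgroup_delta (k : nat) (a : 'Z_(p k)) : vgroup p :=
  dfwith (fun=> 0) k a.

Lemma vgroup_delta_at k a : vgroup_delta k a k = a.
Proof. exact: dfwithin. Qed.

(** At this point the Rademacher function equals $e^{2\pi i/p_k}$, a primitive root of unity of
    order [p k]. The point thus separates the powers, as the injectivity demanded by [lacunary]
    requires. *)
Lemma rademacher_deltaX_inj k : (2 <= p k)%N ->
  {in [pred m | (m < p k)%N] &,
    injective (fun m => rademacher R k (vgroup_delta k 1) ^+ m)}.
Proof.
move=> pk; set z := rademacher _ _ _.
have zE : z = expi (2 * pi / (p k)%:R).
  by rewrite /z /rademacher vgroup_delta_at /= mulr1.
suff H m n : (m < n < p k)%N -> z ^+ m <> z ^+ n.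
  move=> m n /= mp np mn; apply/eqP; case: ltngtP => // h.
  - by case: (H m n); rewrite ?h.
  - by case: (H n m); rewrite ?h.
move=> /andP[mn np]; rewrite -(subnKC (ltnW mn)) exprD.
have z0 : z ^+ m != 0.
  apply/eqP => zm0; have := normcX R z m; rewrite zm0 zE normc_expi Normc.normc0.
  by rewrite expr1n => /eqP; rewrite eq_sym oner_eq0.
rewrite -[X in X <> _]mulr1 => /(mulfI z0)/esym; rewrite zE -expiMn.
have pk0 : 0 < (p k)%:R :> R by rewrite ltr0n; lia.
have pi0 := pi_gt0 R.
apply: expi_neq1; rewrite -[_ *+ (n - m)]mulr_natr mulrAC; apply/andP; split.
  by rewrite divr_gt0 // mulr_gt0 ?mulr_gt0 ?ltr0n ?subn_gt0.
by rewrite ltr_pdivrMr// ltr_pM2l ?mulr_gt0// ltr_nat; lia.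
Qed.

End rademacher_theory.

(** * Haar measure of the digit cylinders *)

Section haar_theory.
Variables (R : realType) (p : nat -> nat).
Implicit Type mu : probability (borel_vgroup p) R.

Definition digit_cylinder k (a : 'Z_(p k)) : set (vgroup p) :=
  [set g | (g k : 'Z_(p k)) = a].

Lemma measurable_digit_cylinder k a :
  measurable (digit_cylinder k a : set (borel_vgroup p)).
Proof.
apply: sub_sigma_algebra.
have -> : digit_cylinder k a =
    (proj k : vgroup p -> discrete_topology 'Z_(p k)) @^-1` [set a] by [].
apply: open_comp; last exact: discrete_open.
by move=> x _; exact: proj_continuous.
Qed.

Lemma haar_digit_cylinder mu k a : (1 < p k)%N -> normalized_haar mu ->
  mu (digit_cylinder k a) = ((p k)%:R^-1)%:E.
Proof.
move=> pk hmu.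
have translate b : mu (digit_cylinder k b) = mu (digit_cylinder k a).
  (* The translation by [b - a] in coordinate [k] alone carries the cylinder of [a] onto that of
     [b]. *)
  rewrite -(hmu (vgroup_delta p k (b - a)) _ (measurable_digit_cylinder k a)).
  congr (mu _); apply/seteqP; split => [g gb|_ [g ga <-]].
    exists (g - vgroup_delta p k (b - a)); last by rewrite addrC subrK.
    rewrite /digit_cylinder /=.
    have -> : (g - vgroup_delta p k (b - a)) k = g k - vgroup_delta p k (b - a) k by [].
    by rewrite vgroup_delta_at gb opprB addrCA subrr addr0.
  rewrite /digit_cylinder /=.
  have -> : (vgroup_delta p k (b - a) + g) k = vgroup_delta p k (b - a) k + g k by [].
  by rewrite vgroup_delta_at ga subrK.
have setTE : setT = \big[setU/set0]_(b < (Zp_trunc (p k)).+2) digit_cylinder k b.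
  by apply/esym/seteqP; split => // g _; rewrite (bigD1 (g k)) //; left.
have : mu setT = 1%E by exact: probability_setT.
rewrite setTE measure_bigsetU_ord; first last.
- by move=> b c _ _ [g [/= <- <-]].
- by move=> b; exact: measurable_digit_cylinder.
rewrite (eq_bigr (fun=> (fine (mu (digit_cylinder k a)))%:E)); last first.
  move=> b _; rewrite fineK; first exact: translate.
  by rewrite fin_num_measure//; exact: measurable_digit_cylinder.
(* ['Z_(p k)] has [p k] elements because [1 < p k]; the common measure is then solved for in the
   reals. *)
rewrite sumEFin sumr_const card_ord Zp_cast// => -[mu1].
rewrite -[LHS]fineK ?fin_num_measure//; last exact: measurable_digit_cylinder.
have p0 : (p k)%:R != 0 :> R by rewrite pnatr_eq0; lia.
by congr EFin; apply: (mulIf p0); rewrite mulVf// mulr_natr.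
Qed.

End haar_theory.

(** * A lower bound for the norm in $L_q$ *)

Section integral_lower_bound.
Context d (T : measurableType d) (R : realType) (mu : {measure set T -> \bar R}).
Local Open Scope ereal_scope.

(* The integral of a nonnegative function is a supremum over the simple
   functions below it, hence monotone without any measurability assumption. *)
Lemma ge0_le_integral_nonmeasurable (f g : T -> \bar R) :
  (forall x, 0 <= f x) -> (forall x, f x <= g x) ->
  \int[mu]_x f x <= \int[mu]_x g x.
Proof.
move=> f0 fg; have g0 x : 0 <= g x by exact: le_trans (fg x).
rewrite !ge0_integralTE//; apply: le_ereal_sup => _ [h hf <-].
by exists h => // x; exact: le_trans (fg x).
Qed.

(** Chebyshev's inequality: integrate $c^q 1_A \le |f|^q$ and take $q$-th roots. *)
Lemma Lnorm_ge_on (f : T -> \bar R) (A : set T) (c q : R) :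
  measurable A -> (0 <= c)%R -> (0 < q)%R -> (forall x, A x -> c%:E <= `|f x|) ->
  c%:E * mu A `^ q^-1 <= 'N[mu]_(q%:E)[f].
Proof.
move=> mA c0 q0 cf; rewrite unlock.
apply: (@le_trans _ _ (((c `^ q)%:E * mu A) `^ q^-1)).
  rewrite poweRM ?lee_fin ?powR_ge0// poweR_EFin -powRrM mulfV ?gt_eqF//.
  by rewrite powRr1.
rewrite gt0_ler_poweR ?invr_ge0 ?(ltW q0)//.
- by rewrite in_itv/= leey andbT mule_ge0// lee_fin powR_ge0.
- by rewrite in_itv/= leey andbT integral_ge0// => x _; exact: poweR_ge0.
have <- : \int[mu]_x ((c `^ q)%:E * (\1_A x)%:E) = (c `^ q)%:E * mu A.
  rewrite ge0_integralZl_EFin ?powR_ge0//; last first.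
    by exact/measurable_EFinP/measurable_indic.
  by rewrite integral_indic// setIT.
apply: ge0_le_integral_nonmeasurable => x.
  by rewrite -EFinM lee_fin mulr_ge0// powR_ge0.
rewrite indicE; case: (boolP (x \in A)) => [/set_mem Ax|_]; last first.
  by rewrite mule0 poweR_ge0.
rewrite mule1 -poweR_EFin gt0_ler_poweR ?(ltW q0)//; last exact: cf.
- by rewrite in_itv/= leey andbT lee_fin.
- by rewrite in_itv/= leey andbT.
Qed.
End integral_lower_bound.

Lemma powR_unbounded (R : realType) (b e : R) : 0 < e ->
  exists M : nat, forall P : nat, (M < P)%N -> b < P%:R `^ e.
Proof.
move=> e0; have := @archi_boundP R (`|b| `^ e^-1) (powR_ge0 _ _).
set M := Num.bound _ => bM; exists M => P MP.
apply: le_lt_trans (ler_norm b) _.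
have -> : `|b| = `|b| `^ e^-1 `^ e by rewrite -powRrM mulVf ?gt_eqF// powRr1.
rewrite gt0_ltr_powR ?nnegrE ?powR_ge0//.
by apply: (lt_trans bM); rewrite ltr_nat.
Qed.

(** A value exceeding both [M] and the maximum of the first [n] terms can only occur at rank [n] or
    later. *)
Lemma exists_large_after (p : nat -> nat) :
  (forall M : nat, exists k, (M < p k)%N) ->
  forall n M : nat, exists2 k, (n <= k)%N & (M < p k)%N.
Proof.
move=> hsup n M; have [k hk] := hsup (maxn M (\max_(i < n) p i)).
exists k; last by apply: leq_ltn_trans hk; exact: leq_maxl.
rewrite leqNgt; apply/negP => kn.
have : (p k <= \max_(i < n) p i)%N by exact: (leq_bigmax (Ordinal kn)).
by move=> pk; move: hk; rewrite ltnNge leq_max pk orbT.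
Qed.

(** * The test sums, with [e] standing for $d-1$ *)

Section chaos_blocks.
Variables (R : realType) (p : nat -> nat) (e K : nat).
Hypotheses (hp : forall k, (2 <= p k)%N) (eK : (e <= K)%N).

Definition chaos_block (m : nat) (g : vgroup p) : R[i] :=
  (\prod_(i < e) rademacher R i g) * rademacher R K g ^+ m.

Lemma chaos_block_in m : (0 < m < p K)%N ->
  @rademacher_chaos R p e.+1 (chaos_block m).
Proof.
move=> hm; exists (fun i : 'I_e.+1 => if (i < e)%N then i : nat else K).
exists (fun i : 'I_e.+1 => if (i < e)%N then 1%N else m); split.
- by move=> a b ab; have := ltn_ord b; case: ifP; case: ifP; lia.
- by move=> i; case: ifP => // _; have := hp i; lia.
- apply/funext => g; rewrite big_ord_recr /= ltnn; congr (_ * _).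
  by apply: eq_bigr => i _; rewrite ltn_ord expr1.
Qed.

Lemma normc_prod_rademacher (g : vgroup p) :
  Normc.normc (\prod_(i < e) rademacher R i g) = 1.
Proof. by rewrite normc_prod big1// => i _; exact: normc_rademacher. Qed.

(** The common factor has modulus 1, so it cancels after evaluation at the point that separates the
    powers. *)
Lemma chaos_block_inj :
  {in [pred m | (m < p K)%N] &, injective chaos_block}.
Proof.
move=> m n mp np /(congr1 (@^~ (vgroup_delta p K 1))) /mulfI mn.
apply: (@rademacher_deltaX_inj R p K (hp K) _ _ mp np); apply: mn.
apply/eqP => P0; have := normc_prod_rademacher (vgroup_delta p K 1).
by rewrite P0 Normc.normc0 => /eqP; rewrite eq_sym oner_eq0.
Qed.

Lemma normc_sum_chaos_block n (g : vgroup p) : (g K : 'Z_(p K)) = 0 ->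
  Normc.normc (\sum_(m < n) 1 * chaos_block m.+1 g) = n%:R.
Proof.
move=> gK; rewrite /chaos_block rademacher_digit0//.
under eq_bigr do rewrite mul1r expr1n mulr1.
by rewrite sumr_const card_ord normcMn normc_prod_rademacher.
Qed.

Lemma lacunary_chaos_block (mu : probability (borel_vgroup p) R) (q kappa : R) :
  normalized_haar mu -> 0 < q ->
  (forall (n : nat) (phi : 'I_n -> borel_vgroup p -> R[i]) (c : 'I_n -> R[i]),
      injective phi -> (forall i, @rademacher_chaos R p e.+1 (phi i)) ->
      ('N[mu]_(q%:E)[(fun x => (Normc.normc (\sum_(i < n) c i * phi i x))%:E)]
         <= (kappa * Num.sqrt (\sum_(i < n) Normc.normc (c i) ^+ 2))%:E)%E) ->
  (p K).-1%:R * (p K)%:R^-1 `^ q^-1 <= kappa * Num.sqrt (p K).-1%:R.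
Proof.
move=> hmu q0 lac; rewrite -lee_fin.
have pK := hp K.
(* All coefficients are 1; the shift [m.+1] makes the exponents run from 1 to [p K - 1], since
   exponent 0 is excluded from the chaos. *)
have := lac (p K).-1 (fun m => chaos_block m.+1) (fun=> 1).
under [in X in Num.sqrt X]eq_bigr do rewrite Normc.normc1 expr1n.
rewrite sumr_const card_ord => H; apply: le_trans (H _ _); last 2 first.
- move=> m n /chaos_block_inj mn; apply/val_inj/succn_inj/mn; rewrite inE.
  + by have := ltn_ord m; lia.
  + by have := ltn_ord n; lia.
- by move=> m; apply: chaos_block_in; have := ltn_ord m; lia.
rewrite EFinM -poweR_EFin -(haar_digit_cylinder _ _ mu K 0)//.
apply: Lnorm_ge_on => //; first exact: measurable_digit_cylinder.
by move=> g gK; rewrite normc_sum_chaos_block// abse_EFin normr_nat.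
Qed.

End chaos_blocks.

Theorem theorem6 (R : realType) (p : nat -> nat)
    (hp : forall k, (2 <= p k)%N)
    (hsup : forall M : nat, exists k, (M < p k)%N)
    (mu : probability (borel_vgroup p) R) (hmu : normalized_haar mu)
    (d : nat) (hd : (1 <= d)%N) (q : R) (hq : 2 < q) :
  ~ lacunary mu q (@rademacher_chaos R p d).
Proof.
case: d hd => // e _ [kappa kappa0 lac].
have q0 : 0 < q by lra.
have exp0 : 0 < 2^-1 - q^-1 by rewrite subr_gt0 ltf_pV2 ?posrE.
(* Beyond [M], $P^{1/2-1/q}$ exceeds $2\kappa$; the rest derives the opposite inequality. *)
have [M hM] := powR_unbounded R (2 * kappa) _ exp0.
have [K eK /hM] := exists_large_after _ hsup e M.
apply/negP; rewrite -leNgt.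
have := lacunary_chaos_block R p e K hp eK mu q kappa hmu q0 lac.
have := hp K; set P := p K => P2.
set x := Num.sqrt P.-1%:R.
have x0 : 0 < x by rewrite sqrtr_gt0 ltr0n; lia.
(* Cancelling one factor $x=\sqrt{P-1}$ leaves $x \le \kappa P^{1/q}$. *)
have -> : P.-1%:R = x * x :> R by rewrite -expr2 sqr_sqrtr.
have P0 : 0 < P%:R :> R by rewrite ltr0n; lia.
rewrite -(powR_inv1 (ltW P0)) -powRrM mulN1r powRN mulrAC ler_pM2r//.
rewrite ler_pdivrMr ?powR_gt0// => xle.
rewrite powRD; last by apply/implyP => _; exact: lt0r_neq0.
rewrite powRN ler_pdivrMr ?powR_gt0// powR12_sqrt ?(ltW P0)// -mulrA.
(* The factor 2 comes from $\sqrt P \le 2\sqrt{P-1}$, that is $P \le 4(P-1)$, valid for $P \ge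
   2$. *)
apply: (@le_trans _ _ (2 * x)); last by rewrite ler_pM2l.
rewrite -(@ler_pXn2r _ 2) ?nnegrE ?sqrtr_ge0 ?mulr_ge0 ?(ltW x0)//.
rewrite exprMn !sqr_sqrtr ?ler0n// -natrX -natrM ler_nat; lia.
Qed.
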